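(* Let $x\in\mathbb{R}^n$, $\sigma>0$, and let $\mathcal{X}=\{x,x+\sigma u_1,\dots,x+\sigma u_n\}$ be a set of interpolation points with $u_i\in\mathbb{R}^n$, $\max_i\|u_i\|\le1$, and such that the matrix $Q_{\mathcal{X}}\in\mathbb{R}^{n\times n}$ whose rows are $u_1^T,\dots,u_n^T$ is nonsingular. Assume that $f(y)=\phi(y)+\epsilon(y)$ for all $y\in\mathbb{R}^n$, where $\phi:\mathbb{R}^n\to\mathbb{R}$ is continuously differentiable with $L$-Lipschitz continuous gradient, and $|\epsilon(y)|\le\epsilon_f$ for all $y\in\mathbb{R}^n$. Let $g(x)=\frac1\sigma Q_{\mathcal{X}}^{-1}F_{\mathcal{X}}$, where $F_{\mathcal{X}}\in\mathbb{R}^n$ has entries $f(x+\sigma u_i)-f(x)$, $i=1,\dots,n$. Then $$\|g(x)-\nabla\phi(x)\|\le\frac{\|Q_{\mathcal{X}}^{-1}\|_2\sqrt n\,\sigma L}{2}+\frac{2\|Q_{\mathcal{X}}^{-1}\|_2\sqrt n\,\epsilon_f}{\sigma}.$$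
   Context: $\|\cdot\|$ is the Euclidean norm and $\|\cdot\|_2$ the spectral norm of a matrix. The vector $g(x)$ is the gradient of the linear interpolation model $m(y)=f(x)+g(x)^T(y-x)$ satisfying $m(x+\sigma u_i)=f(x+\sigma u_i)$ for $i=1,\dots,n$, i.e. the solution of $\sigma Q_{\mathcal{X}}g(x)=F_{\mathcal{X}}$. *)

(* Defs.v *)
From HB Require Import structures.
From mathcomp Require Import all_boot all_order all_algebra.
From mathcomp Require Import all_classical all_reals all_analysis.

Set Implicit Arguments.
Unset Strict Implicit.
Unset Printing Implicit Defensive.

Import Order.TTheory GRing.Theory Num.Theory.
Import numFieldNormedType.Exports.

Local Open Scope classical_set_scope.
Local Open Scope ring_scope.

(* MathComp-Analysis equips 'cV[R]_n with the sup norm; the Euclidean norm is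
   therefore a separate function. The two norms are equivalent, so continuity
   and differentiability on 'cV[R]_n have their usual meaning. *)
Definition enorm (R : realType) (n : nat) (v : 'cV[R]_n) : R :=
  Num.sqrt (\sum_(i < n) v i ord0 ^+ 2).

(* The operator norm induced by the Euclidean norm. The set is nonempty (it
   contains 0) and bounded above, so this is a genuine supremum. *)
Definition spectral_norm (R : realType) (m n : nat) (A : 'M[R]_(m, n)) : R :=
  sup [set enorm (A *m v) | v in [set v : 'cV[R]_n | enorm v <= 1]].

Definition gradient (R : realType) (n : nat) (phi : 'cV[R]_n -> R)
    (x : 'cV[R]_n) : 'cV[R]_n :=
  \col_(i < n) 'D_(delta_mx i ord0) phi x.

Definition continuously_differentiable (R : realType) (n : nat)
    (phi : 'cV[R]_n -> R) : Prop :=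
  (forall y, differentiable phi y) /\ continuous (gradient phi).

Definition lipschitz_gradient (R : realType) (n : nat) (L : R)
    (phi : 'cV[R]_n -> R) : Prop :=
  forall y z, enorm (gradient phi y - gradient phi z) <= L * enorm (y - z).

Definition interp_mx (R : realType) (n : nat) (u : 'I_n -> 'cV[R]_n) :
    'M[R]_n :=
  \matrix_(i < n) (u i)^T.

Definition interp_diff (R : realType) (n : nat) (f : 'cV[R]_n -> R)
    (x : 'cV[R]_n) (sigma : R) (u : 'I_n -> 'cV[R]_n) : 'cV[R]_n :=
  \col_(i < n) (f (x + sigma *: u i) - f x).

(* When interp_mx u is nonsingular and sigma != 0, this is the unique g with
   sigma *: (interp_mx u *m g) = interp_diff f x sigma u, i.e. the gradient of
   the linear model y |-> f x + g^T (y - x) that interpolates f at the points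
   x + sigma *: u i. *)
Definition interp_gradient (R : realType) (n : nat) (f : 'cV[R]_n -> R)
    (x : 'cV[R]_n) (sigma : R) (u : 'I_n -> 'cV[R]_n) : 'cV[R]_n :=
  sigma^-1 *: (invmx (interp_mx u) *m interp_diff f x sigma u).

(* Main.v *)
Require Import Defs.
From HB Require Import structures.
From mathcomp Require Import all_boot all_order all_algebra.
From mathcomp Require Import all_classical all_reals all_analysis.
From mathcomp Require Import ring lra.

(** The estimate rests on two facts.

    Taylor with a Lipschitz gradient ([taylor1_remainder_le]): the first-order
    Taylor remainder of phi at x for a displacement v is at most L |v|^2 / 2,
    since along the segment its derivative at time t is the pairing of
    grad phi (x + t v) - grad phi x with v, hence at most L t |v|^2 by
    Cauchy-Schwarz.

    Stability of the linear system: with Q the matrix of rows u_i^T,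
    sigma Q (g - grad phi x) is the residual vector whose i-th entry is
    f (x + sigma u_i) - f x - sigma <grad phi x, u_i>, that is, a Taylor
    remainder (at most L sigma^2 / 2, as |u_i| <= 1) plus a difference of two
    noise values (at most 2 eps_f).  A vector with entries at most B in absolute
    value has Euclidean norm at most sqrt n B, and applying Q^-1 / sigma costs
    the factor |Q^-1|_2 / sigma ([enorm_mulmx_le]).  That last step requires the
    supremum defining the spectral norm to be taken over a bounded set, which
    Cauchy-Schwarz applied row by row provides. *)

Set Implicit Arguments.
Unset Strict Implicit.
Unset Printing Implicit Defensive.

Import Order.TTheory GRing.Theory Num.Theory.
Import numFieldNormedType.Exports.

Local Open Scope ring_scope.

(** * Euclidean norm and spectral norm *)

Definition edot (R : realType) (n : nat) (v w : 'cV[R]_n) : R :=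
  \sum_(i < n) v i ord0 * w i ord0.

Lemma enorm_ge0 (R : realType) (n : nat) (v : 'cV[R]_n) : 0 <= enorm v.
Proof. exact: sqrtr_ge0. Qed.

Lemma sqr_enorm (R : realType) (n : nat) (v : 'cV[R]_n) :
  enorm v ^+ 2 = \sum_(i < n) v i ord0 ^+ 2.
Proof. by rewrite sqr_sqrtr // sumr_ge0 // => i _; rewrite sqr_ge0. Qed.

Lemma enormZ (R : realType) (n : nat) (a : R) (v : 'cV[R]_n) :
  enorm (a *: v) = `|a| * enorm v.
Proof.
rewrite /enorm -sqrtr_sqr -sqrtrM ?sqr_ge0 // mulr_sumr.
by congr Num.sqrt; apply: eq_bigr => i _; rewrite mxE exprMn.
Qed.

Lemma enorm_eq0 (R : realType) (n : nat) (v : 'cV[R]_n) :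
  enorm v = 0 -> v = 0.
Proof.
move=> v0; apply/colP => i; rewrite mxE; apply/eqP; rewrite -sqrf_eq0.
have /eqP : \sum_(i < n) v i ord0 ^+ 2 = 0 by rewrite -sqr_enorm v0 expr0n.
rewrite psumr_eq0 => [/allP/(_ i)|j _]; last by rewrite sqr_ge0.
by rewrite mem_index_enum => /(_ isT).
Qed.

(** Cauchy-Schwarz, from the nonnegativity of the squared norm of
    |w|^2 v - <v, w> w. *)
Lemma edot_le (R : realType) (n : nat) (v w : 'cV[R]_n) :
  `|edot v w| <= enorm v * enorm w.
Proof.
have [w0|w0] := eqVneq (enorm w) 0.
  rewrite (enorm_eq0 w0) /edot big1 ?normr0 ?mulr_ge0 ?enorm_ge0 // => i _.
  by rewrite mxE mulr0.
have w2_gt0 : 0 < enorm w ^+ 2 by rewrite exprn_gt0 // lt_def w0 enorm_ge0.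
rewrite -ler_sqr ?nnegrE ?mulr_ge0 ?enorm_ge0 // real_normK ?num_real //.
rewrite exprMn -subr_ge0 -(pmulr_rge0 _ w2_gt0).
set b := enorm w ^+ 2; set c := edot v w.
have -> : b * (enorm v ^+ 2 * b - c ^+ 2) =
    \sum_(i < n) (b * v i ord0 - c * w i ord0) ^+ 2.
  transitivity (b ^+ 2 * (\sum_(i < n) v i ord0 ^+ 2) +
      (- 2 * b * c) * (\sum_(i < n) v i ord0 * w i ord0) +
      c ^+ 2 * (\sum_(i < n) w i ord0 ^+ 2)).
    by rewrite -!sqr_enorm -/(edot v w) -/b -/c; ring.
  clearbody b c; rewrite !mulr_sumr -!big_split /=.
  by apply: eq_bigr => i _; ring.
by rewrite sumr_ge0 // => i _; rewrite sqr_ge0.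
Qed.

Lemma enorm_le_sqrt_dim (R : realType) (n : nat) (B : R) (v : 'cV[R]_n) :
  (forall i, `|v i ord0| <= B) -> enorm v <= Num.sqrt n%:R * B.
Proof.
case: n v => [|n] v vB; first by rewrite /enorm big_ord0 sqrtr0 mul0r.
have B0 : 0 <= B by rewrite (le_trans _ (vB ord0)).
rewrite -ler_sqr ?nnegrE ?mulr_ge0 ?enorm_ge0 ?sqrtr_ge0 //.
rewrite exprMn sqr_enorm sqr_sqrtr //.
rewrite (_ : _ * _ = \sum_(i < n.+1) B ^+ 2); last first.
  by rewrite sumr_const card_ord mulr_natl.
apply: ler_sum => i _; rewrite -real_normK ?num_real //.
by rewrite lerXn2r ?nnegrE.
Qed.

(** Row by row, Cauchy-Schwarz bounds |A v| on the unit ball, so the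
    supremum in the spectral norm is an actual upper bound. *)
Lemma enorm_mulmx_unit_le (R : realType) (m n : nat) (A : 'M[R]_(m, n))
    (v : 'cV[R]_n) :
  enorm v <= 1 -> enorm (A *m v) <= spectral_norm A.
Proof.
move=> v1; apply: ub_le_sup; last by exists v.
exists (Num.sqrt m%:R * \sum_(i < m) enorm (row i A)^T) => _ [w /= w1 <-].
apply: enorm_le_sqrt_dim => i.
have -> : (A *m w) i ord0 = edot (row i A)^T w.
  by rewrite mxE; apply: eq_bigr => j _; rewrite !mxE.
apply: le_trans (edot_le _ _) _.
rewrite (bigD1 i) //= (le_trans (ler_piMr (enorm_ge0 _) w1)) // lerDl.
by rewrite sumr_ge0 // => j _; rewrite enorm_ge0.
Qed.

Lemma enorm_mulmx_le (R : realType) (m n : nat) (A : 'M[R]_(m, n))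
    (v : 'cV[R]_n) :
  enorm (A *m v) <= spectral_norm A * enorm v.
Proof.
have [v0|v0] := eqVneq (enorm v) 0.
  by rewrite v0 mulr0 (enorm_eq0 v0) mulmx0 -(scale0r 0) enormZ normr0 mul0r.
have v_gt0 : 0 < enorm v by rewrite lt_def v0 enorm_ge0.
have := @enorm_mulmx_unit_le _ _ _ A ((enorm v)^-1 *: v).
rewrite -scalemxAr !enormZ ger0_norm ?invr_ge0 ?enorm_ge0 // mulVf // lexx.
by move=> /(_ isT); rewrite mulrC ler_pdivrMr.
Qed.

Lemma spectral_norm_ge0 (R : realType) (m n : nat) (A : 'M[R]_(m, n)) :
  0 <= spectral_norm A.
Proof.
apply: le_trans (enorm_ge0 (A *m 0)) (enorm_mulmx_unit_le _ _).
by rewrite -(scale0r 0) enormZ normr0 mul0r ler01.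
Qed.

(** * Taylor remainder under a Lipschitz gradient *)

Lemma derive_gradient (R : realType) (n : nat) (phi : 'cV[R]_n -> R)
    (y v : 'cV[R]_n) :
  differentiable phi y -> 'D_v phi y = edot (gradient phi y) v.
Proof.
move=> dphi; rewrite deriveE // [in LHS](matrix_sum_delta v) linear_sum.
apply: eq_bigr => i _; rewrite big_ord1 linearZ /= mxE deriveE //.
by rewrite mulrC.
Qed.

Lemma is_derive_line (R : realType) (n : nat) (phi : 'cV[R]_n -> R)
    (x v : 'cV[R]_n) (t : R) :
  differentiable phi (x + t *: v) ->
  is_derive t 1 (fun s : R => phi (x + s *: v))
    (edot (gradient phi (x + t *: v)) v).
Proof.
move=> dphi; rewrite -derive_gradient //.
(* The two difference quotients agree before passing to the limit, so no chain
   rule enters. *)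
have qE : (fun h : R => h^-1 *: (((fun s : R => phi (x + s *: v)) \o shift t)
    (h *: 1) - phi (x + t *: v))) =
  (fun h : R => h^-1 *: ((phi \o shift (x + t *: v)) (h *: v) -
    phi (x + t *: v))).
  apply/funext => h /=.
  by rewrite [h%:A]mulr1 scalerDl addrCA.
apply: DeriveDef; first by rewrite /derivable qE; exact: diff_derivable.
by rewrite /derive qE.
Qed.

(** Comparison with the parabola c t^2, whose increment over [0, 1] is c: the
    difference has a nonpositive derivative, so the mean value theorem makes
    its increment nonpositive. *)
Lemma increment_le_of_deriv_le (R : realType) (h dh : R -> R) (c : R) :
  (forall t : R, is_derive t 1 h (dh t)) ->
  (forall t : R, 0 <= t -> dh t <= 2 * c * t) -> h 1 - h 0 <= c.
Proof.
move=> hd dh_le.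
pose k : R -> R := h - (fun t => c * t ^+ 2).
have kd (t : R) : is_derive t 1 k (dh t - 2 * c * t).
  have -> : k = h - c *: (@GRing.exp R ^~ 2%N) by [].
  apply: is_derive_eq.
  by rewrite /GRing.scale /=; ring.
have kc : {within `[0, 1], continuous k}%classic.
  by apply: derivable_within_continuous => t _; case: (kd t).
have [t] := MVT ltr01 (fun t _ => kd t) kc.
rewrite in_itv /= => /andP[/ltW t0 _].
rewrite /k !fctE subr0 mulr1 => kE.
have := dh_le _ t0; lra.
Qed.

(** The remainder is the increment over [0, 1] of h below, whose derivative at
    t is at most L |v|^2 t in absolute value; comparing h and - h with the
    parabola (L / 2) |v|^2 t^2 gives the two sides of the bound. *)
Lemma taylor1_remainder_le (R : realType) (n : nat) (L : R)
    (phi : 'cV[R]_n -> R) (x v : 'cV[R]_n) :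
  (forall y, differentiable phi y) -> lipschitz_gradient L phi ->
  `|phi (x + v) - phi x - edot (gradient phi x) v| <= L / 2 * enorm v ^+ 2.
Proof.
move=> dphi phi_lip.
pose d t := edot (gradient phi (x + t *: v)) v - edot (gradient phi x) v.
pose h (t : R) : R := phi (x + t *: v) - t * edot (gradient phi x) v.
have hd (t : R) : is_derive t 1 h (d t).
  have /= dline := is_derive_line (dphi (x + t *: v)).
  have -> : h = (fun s : R => phi (x + s *: v)) -
                edot (gradient phi x) v *: id.
    by apply/funext => s; rewrite /h !fctE /GRing.scale /= mulrC.
  by apply: is_derive_eq; rewrite /d /GRing.scale /= mulr1.
have d_le (t : R) : 0 <= t -> `|d t| <= 2 * (L / 2 * enorm v ^+ 2) * t.
  move=> t0.
  have -> : d t = edot (gradient phi (x + t *: v) - gradient phi x) v.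
    by rewrite /d /edot -sumrB; apply: eq_bigr => i _; rewrite !mxE mulrBl.
  apply: le_trans (edot_le _ _) _.
  have := ler_wpM2r (enorm_ge0 v) (phi_lip (x + t *: v) x).
  rewrite [x + _]addrC addrK enormZ ger0_norm // => /le_trans; apply.
  by rewrite le_eqVlt; apply/orP; left; apply/eqP; field.
have -> : phi (x + v) - phi x - edot (gradient phi x) v = h 1 - h 0.
  by rewrite /h scale1r scale0r addr0; ring.
rewrite ler_norml; apply/andP; split; last first.
  apply: increment_le_of_deriv_le hd _ => t t0.
  exact: le_trans (ler_norm _) (d_le t t0).
suff : (- h) 1 - (- h) 0 <= L / 2 * enorm v ^+ 2.
  by rewrite !fctE; lra.
apply: (@increment_le_of_deriv_le _ _ (fun t => - d t)) => t t0.
by rewrite (le_trans _ (d_le t t0)) // -normrN ler_norm.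
Qed.

(** * Error of the interpolation gradient *)

(** In dimension 0 every L is a Lipschitz constant; the index i excludes
    this case. *)
Lemma lipschitz_gradient_ge0 (R : realType) (n : nat) (i : 'I_n) (L : R)
    (phi : 'cV[R]_n -> R) :
  lipschitz_gradient L phi -> 0 <= L.
Proof.
move=> /(_ (delta_mx i ord0) 0); rewrite subr0.
move=> /(le_trans (enorm_ge0 _)); rewrite pmulr_lge0 // lt_def enorm_ge0 andbT.
apply/eqP => /enorm_eq0/colP/(_ i)/eqP.
by rewrite !mxE !eqxx oner_eq0.
Qed.

Theorem theorem3p1 (R : realType) (n : nat) (x : 'cV[R]_n) (sigma : R)
    (u : 'I_n -> 'cV[R]_n) (f phi eps : 'cV[R]_n -> R) (L eps_f : R)
    (sigma_gt0 : 0 < sigma)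
    (u_le1 : forall i : 'I_n, enorm (u i) <= 1)
    (Q_unit : interp_mx u \in unitmx)
    (fE : forall y : 'cV[R]_n, f y = phi y + eps y)
    (phi_C1 : continuously_differentiable phi)
    (phi_lip : lipschitz_gradient L phi)
    (eps_le : forall y : 'cV[R]_n, `|eps y| <= eps_f) :
  enorm (interp_gradient f x sigma u - gradient phi x) <=
    spectral_norm (invmx (interp_mx u)) * Num.sqrt n%:R * sigma * L / 2 +
    2 * spectral_norm (invmx (interp_mx u)) * Num.sqrt n%:R * eps_f / sigma.
Proof.
have sigma_neq0 : sigma != 0 by rewrite gt_eqF.
set Q := interp_mx u.
pose r := interp_diff f x sigma u - sigma *: (Q *m gradient phi x).
have -> : interp_gradient f x sigma u - gradient phi x =
    sigma^-1 *: (invmx Q *m r).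
  rewrite /interp_gradient -/Q /r mulmxBr -scalemxAr mulKmx // scalerBr.
  by rewrite scalerA mulVf // scale1r.
have r_le i : `|r i ord0| <= L / 2 * sigma ^+ 2 + 2 * eps_f.
  have L_ge0 := lipschitz_gradient_ge0 i phi_lip.
  have -> : r i ord0 = f (x + sigma *: u i) - f x -
      edot (gradient phi x) (sigma *: u i).
    rewrite 5!mxE mulr_sumr; congr (_ - _); apply: eq_bigr => j _.
    by rewrite !mxE; ring.
  have := taylor1_remainder_le x (sigma *: u i) (proj1 phi_C1) phi_lip.
  rewrite enormZ (gtr0_norm sigma_gt0) exprMn => rem.
  have u2_le1 : enorm (u i) ^+ 2 <= 1 by rewrite expr_le1 ?enorm_ge0.
  have {}rem := le_trans rem (ler_wpM2l (divr_ge0 L_ge0 (ler0n _ 2))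
    (ler_piMr (sqr_ge0 sigma) u2_le1)).
  rewrite !fE; move: rem (eps_le (x + sigma *: u i)) (eps_le x).
  rewrite !ler_norml.
  by move=> /andP[? ?] /andP[? ?] /andP[? ?]; apply/andP; split; lra.
rewrite enormZ gtr0_norm ?invr_gt0 // mulrC ler_pdivrMr //.
apply: le_trans (enorm_mulmx_le _ _) _.
apply: le_trans (ler_wpM2l (spectral_norm_ge0 _) (enorm_le_sqrt_dim r_le)) _.
by rewrite le_eqVlt; apply/orP; left; apply/eqP; field.
Qed.
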